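(* In the setting of the context, suppose: (i) there are constants $0<L_1,U_1<\infty$ with $L_1\{\|v_1\|^2_{\mathcal{E}(\Omega)}+\|v_2\|^2_{\mathcal{E}(\Omega)}\}\le|B(v_1+v_2,v_1+v_2)|\le U_1\{\|v_1\|^2_{\mathcal{E}(\Omega)}+\|v_2\|^2_{\mathcal{E}(\Omega)}\}$ for all $v_1\in\mathcal{S}_1$, $v_2\in\overline{\mathcal{S}}_2$; (ii) there are constants $0<L_2,U_2<\infty$ such that for every enriched element $\tau_k$, $L_2\|[D^{(k)}]^{-1}\mathbf{x}\|^2\le\mathbf{x}^TA^{(k)}_{22}\mathbf{x}\le U_2\|[D^{(k)}]^{-1}\mathbf{x}\|^2$ for all $\mathbf{x}\in\mathbb{R}^{\varsigma^{(k)}}$; (iii) there are constants $0<L_3,U_3<\infty$ such that for every $x_i\in\mathcal{T}_2$, $L_3\le(\mathbf{A}_{22})^{-1}_{x_ix_i}\Delta_i\le U_3$, where $(\mathbf{A}_{22})_{x_ix_i}=B(N_i\bar\phi^i,N_i\bar\phi^i)$ is the diagonal entry of $\mathbf{A}_{22}$ associated with $x_i$. Then \[ \frac{L_1}{U_1}\,\mathfrak{K}(\mathbf{A}_{11})\le\mathfrak{K}(\mathbf{A})\le\mathfrak{K}(\mathbf{A}_{11})\,\frac{U_1}{L_1}\,\frac{\max\{1,\,U_2U_3/\lambda_{\max}(\widehat{\mathbf{A}}_{11})\}}{\min\{1,\,L_2L_3/\lambda_{\min}(\widehat{\mathbf{A}}_{11})\}}, \] where $\lambda_{\min}(\widehat{\mathbf{A}}_{11})$,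 $\lambda_{\max}(\widehat{\mathbf{A}}_{11})$ are the smallest and largest eigenvalues of $\widehat{\mathbf{A}}_{11}$.
   Context: $\Omega=(0,1)$, $a\in L^\infty(\Omega)$, $0<\alpha\le a\le\beta$, $B(u,v)=\int_\Omega au'v'\,dx$, $B_\tau(u,v)=\int_\tau au'v'\,dx$, $\|v\|_{\mathcal{E}(\omega)}=(\int_\omega a|v'|^2dx)^{1/2}$. Uniform mesh $x_k=kh$, $h=1/N$, $k=0,\dots,N$, $\mathcal{T}=\{x_0,\dots,x_N\}$, elements $\tau_k=[x_{k-1},x_k]$, $k=1,\dots,N$; hat functions $N_i$ with $N_i(x_j)=\delta_{ij}$; patches $\omega_i=(x_{i-1},x_{i+1})\cap\Omega$ with vertices the mesh points among $x_{i-1},x_i,x_{i+1}$; $I_{\omega_i}w$ is the piecewise linear interpolant of $w$ on $\omega_i$ at its vertices. For each $x_i$, a function $\phi^i\in H^1(\omega_i)$ is given and $\bar\phi^i=\phi^i-I_{\omega_i}\phi^i$; $\mathcal{T}_2=\{x_i:\bar\phi^i\not\equiv0\}$, $\zeta_2=\mathrm{card}\,\mathcal{T}_2$; $\mathcal{T}_1=\{x_1,\dots,x_N\}$, $\zeta_1=N$. $\mathcal{S}_1=\mathrm{span}\{N_i\}_{x_i\in\mathcal{T}_1}$, $\overline{\mathcal{S}}_2=\mathrm{span}\{N_i\bar\phi^i\}_{x_i\in\mathcal{T}_2}$ (extended by zero). $\mathbf{A}$ is the stiffness matrix of $B$ for the basis $\{N_i\}_{x_i\in\mathcal{T}_1}$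 followed by $\{N_i\bar\phi^i\}_{x_i\in\mathcal{T}_2}$, with diagonal blocks $\mathbf{A}_{11}=\{B(N_i,N_j)\}_{\mathcal{T}_1}$, $\mathbf{A}_{22}=\{B(N_i\bar\phi^i,N_j\bar\phi^j)\}_{\mathcal{T}_2}$. Scaled condition number: for a symmetric positive definite $\mathbf{M}$ with diagonal $\mathbf{D}_\mathbf{M}$, $\widehat{\mathbf{M}}=\mathbf{D}_\mathbf{M}^{-1/2}\mathbf{M}\mathbf{D}_\mathbf{M}^{-1/2}$ (unit diagonal) and $\mathfrak{K}(\mathbf{M})=\lambda_{\max}(\widehat{\mathbf{M}})/\lambda_{\min}(\widehat{\mathbf{M}})$; in particular $\widehat{\mathbf{A}}_{11}$ is $\mathbf{A}_{11}$ scaled by its diagonal. Element matrices: for $k=1,\dots,N$ and $i,j\in\{1,2\}$ let $b^{(k)}_{ij}=B_{\tau_k}(N_{k-2+i}\bar\phi^{k-2+i},N_{k-2+j}\bar\phi^{k-2+j})$, where a term with $x_{k-2+i}\notin\mathcal{T}_2$ (or $\bar\phi^{k-2+i}\equiv0$ on $\tau_k$) is taken as $0$. The element $\tau_k$ is enriched if $b^{(k)}_{11}>0$ or $b^{(k)}_{22}>0$ (equivalently, $x_{k-1}\in\mathcal{T}_2$ with $\bar\phi^{k-1}|_{\tau_k}\not\equiv0$, or $x_k\in\mathcal{T}_2$ with $\bar\phi^k|_{\tau_k}\not\equiv0$). The local vertex $x^{(k)}_l:=x_{k-2+l}$ ($l=1,2$) is associated with $\tau_k$'s matrix if $b^{(k)}_{ll}>0$;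 $\varsigma^{(k)}\in\{1,2\}$ is the number of associated vertices and $A^{(k)}_{22}$ is the $\varsigma^{(k)}\times\varsigma^{(k)}$ submatrix of $(b^{(k)}_{ij})$ on the associated indices. If $\varsigma^{(k)}=2$, $D^{(k)}=\mathrm{diag}\{\delta^{(k)}_1,\delta^{(k)}_2\}$ with given positive numbers $\delta^{(k)}_1,\delta^{(k)}_2$; if only the local index $l$ is associated, $D^{(k)}=[\delta^{(k)}_l]$ with $\delta^{(k)}_l=(b^{(k)}_{ll})^{-1/2}$. For $x_i\in\mathcal{T}_2$: $\mathcal{K}^*_i$ is the set of enriched elements $\tau_k\subset\overline{\omega}_i$ with $\bar\phi^i|_{\tau_k}\not\equiv0$; $l(i,k)\in\{1,2\}$ is the local index with $x^{(k)}_{l(i,k)}=x_i$ (i.e. $l(i,i)=2$, $l(i,i+1)=1$); and $\Delta_i=\sum_{\tau_k\in\mathcal{K}^*_i}[\delta^{(k)}_{l(i,k)}]^{-2}$. *)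

(* Defs.v *)
From HB Require Import structures.
From mathcomp Require Import all_boot all_order all_algebra.
From mathcomp Require Import all_classical all_reals all_analysis.
Set Implicit Arguments. Unset Strict Implicit. Unset Printing Implicit Defensive.
Import Order.TTheory GRing.Theory Num.Theory.
Local Open Scope ring_scope.
Local Open Scope classical_set_scope.

Section LinAlg.
Variable R : realType.

Definition lam_max n (M : 'M[R]_n) : R := sup [set a : R | eigenvalue M a].
Definition lam_min n (M : 'M[R]_n) : R := inf [set a : R | eigenvalue M a].

Definition scaled n (M : 'M[R]_n) : 'M[R]_n :=
  let Dm := diag_mx (\row_i (Num.sqrt (M i i))^-1) in Dm *m M *m Dm.

Definition scond n (M : 'M[R]_n) : R :=
  lam_max (scaled M) / lam_min (scaled M).
End LinAlg.

Section FEM.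
Variable R : realType.
Variable N : nat.
Variable a : R -> R.
Variable phi : nat -> R -> R.
Variable dphi : nat -> R -> R.

Definition mu := (@lebesgue_measure R).
Definition hh : R := (N%:R)^-1.
Definition xn (k : nat) : R := k%:R / N%:R.

(* patch \omega_i = (x_{i-1}, x_{i+1}) \cap (0,1) : endpoints *)
Definition plo (i : nat) : R := xn i.-1.
Definition phi_hi (i : nat) : R := xn (minn i.+1 N).

(* \phi^i \in H^1(\omega_i), written as: dphi i \in L^2(\omega_i) and
   \phi^i is the absolutely continuous function with derivative dphi i *)
Definition inH1 (i : nat) : Prop :=
  measurable_fun `](plo i), (phi_hi i)[ (dphi i) /\
  (\int[mu]_(x in `](plo i), (phi_hi i)[) ((dphi i x) ^+ 2)%:E < +oo)%E /\
  forall x, plo i <= x <= phi_hi i ->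
    phi i x = phi i (plo i) + fine (\int[mu]_(t in `[(plo i), x]) (dphi i t)%:E).

(* element tau_k = [x_{k-1}, x_k], k = 1..N *)
Definition valid_el (k : nat) : bool := (1 <= k <= N)%N.

(* \bar\phi^i = \phi^i - I_{\omega_i}\phi^i, on the element tau_k *)
Definition phibar (i k : nat) (x : R) : R :=
  phi i x - (phi i (xn k.-1)
             + (x - xn k.-1) / hh * (phi i (xn k) - phi i (xn k.-1))).

Definition dphibar (i k : nat) (x : R) : R :=
  dphi i x - (phi i (xn k) - phi i (xn k.-1)) / hh.

(* hat function N_i on \omega_i, and its derivative on tau_k *)
Definition Nhat (i : nat) (x : R) : R := 1 - `|x - xn i| / hh.
Definition dNhat (i k : nat) : R :=
  if k == i then hh^-1 else if k == i.+1 then - hh^-1 else 0.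

Definition nz_el (i k : nat) : Prop :=
  exists x, xn k.-1 <= x <= xn k /\ phibar i k x != 0.

(* T_2 : nodes x_i (i = 0..N) with \bar\phi^i \not\equiv 0 on \omega_i *)
Definition T2 : {set 'I_N.+1} :=
  [set i : 'I_N.+1 | `[< (valid_el i /\ nz_el i i) \/
                         (valid_el i.+1 /\ nz_el i i.+1) >] ].

Definition z2 := #|T2|.

(* derivative on tau_k of the enrichment function N_i \bar\phi^i
   (zero on elements outside \omega_i) *)
Definition dpsi (i k : nat) (x : R) : R :=
  if (k == i) || (k == i.+1) then
    dNhat i k * phibar i k x + Nhat i x * dphibar i k x
  else 0.

(* A function v in S_1 + \bar S_2 is represented by its elementwise
   derivatives dv k (derivative of v on tau_k).
   B_{tau_k}(u,v) and B(u,v) = sum_k B_{tau_k}(u,v). *)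
Definition Bel (k : nat) (du dv : R -> R) : R :=
  fine (\int[mu]_(x in `[(xn k.-1), (xn k)]) (a x * du x * dv x)%:E).
Definition Bform (du dv : nat -> R -> R) : R :=
  \sum_(1 <= k < N.+1) Bel k (du k) (dv k).
Definition enorm2 (dv : nat -> R -> R) : R := Bform dv dv.

Definition dS1 (c : 'I_N -> R) (k : nat) (x : R) : R :=
  \sum_(i < N) c i * dNhat i.+1 k.
Definition dS2 (d : 'I_z2 -> R) (k : nat) (x : R) : R :=
  \sum_(j < z2) d j * dpsi (enum_val j) k x.

Definition basis_d (s : 'I_(N + z2)) (k : nat) (x : R) : R :=
  match fintype.split s with
  | inl i => dNhat i.+1 k
  | inr j => dpsi (enum_val j) k x
  end.
Definition Amat : 'M[R]_(N + z2) :=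
  \matrix_(s, t) Bform (basis_d s) (basis_d t).
Definition A11 : 'M[R]_N := ulsubmx Amat.
Definition A22 : 'M[R]_z2 := drsubmx Amat.

(* element matrices: local index l : 'I_2 (l = 0,1 corresponds to the
   paper's 1,2), local vertex x^{(k)}_l = x_{k-1+l} *)
Definition gate (k : nat) (l : 'I_2) : bool :=
  let i := (k.-1 + l)%N in
  (i <= N)%N && (inord i \in T2) && `[< nz_el i k >].
Definition bel (k : nat) (l m : 'I_2) : R :=
  if gate k l && gate k m then
    Bel k (dpsi (k.-1 + l)%N k) (dpsi (k.-1 + m)%N k)
  else 0.

Definition enriched (k : nat) : bool :=
  (0 < bel k 0 0) || (0 < bel k 1 1).
Definition assoc (k : nat) (l : 'I_2) : bool := 0 < bel k l l.

Definition deff (delta : nat -> 'I_2 -> R) (k : nat) (l : 'I_2) : R :=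
  if assoc k 0 && assoc k 1 then delta k l else (Num.sqrt (bel k l l))^-1.

(* Delta_i = sum over tau_k in K*_i of [delta^{(k)}_{l(i,k)}]^{-2};
   tau_i has l(i,i) = 2 (index 1 here), tau_{i+1} has l(i,i+1) = 1 (index 0) *)
Definition inKstar (i k : nat) : bool :=
  valid_el k && ((k == i) || (k == i.+1)) && enriched k && `[< nz_el i k >].
Definition Delta (delta : nat -> 'I_2 -> R) (i : nat) : R :=
  (if inKstar i i then (deff delta i 1)^-2 else 0) +
  (if inKstar i i.+1 then (deff delta i.+1 0)^-2 else 0).

End FEM.

(* Main.v *)
(** The scaled matrix is a congruence of the original by a diagonal matrix, so
    extreme eigenvalues are compared through Rayleigh quotients.  Hypothesis (i)
    makes the energy form equivalent, with constants [L1] and [U1], to the block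
    diagonal form of [A11] and [A22].  Summing (ii) over the elements compares
    the form of [A22] at [z] with [\sum_j z_j^2 Delta_j], because the elements
    adjacent to [x_j] contribute exactly the terms of [Delta_j]; by (iii) this
    is comparable with the diagonal of [A22], so the spectrum of the scaled
    [A22] lies in [[L2 L3, U2 U3]].  The lower bound is interlacing for a
    principal submatrix together with [L1 <= U1]. *)
Require Import Defs.
From HB Require Import structures.
From mathcomp Require Import all_boot all_order all_algebra.
From mathcomp Require Import all_classical all_reals all_analysis.
From mathcomp Require Import measurable_realfun ring lra.
Import Order.TTheory GRing.Theory Num.Theory.
Import numFieldNormedType.Exports.
Local Open Scope ring_scope.
Local Open Scope classical_set_scope.

(** * Quadratic forms and extreme eigenvalues *)

(** Row vectors are used because [eigenvalue] refers to left eigenvectors. *)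
Definition qform {R : realType} {n} (M : 'M[R]_n) (x : 'rV[R]_n) : R :=
  (x *m M *m x^T) 0 0.

Definition sqn {R : realType} {n} (x : 'rV[R]_n) : R := (x *m x^T) 0 0.

Lemma qformE {R : realType} {n} (M : 'M[R]_n) (x : 'rV[R]_n) :
  qform M x = \sum_i \sum_j x 0 i * M i j * x 0 j.
Proof.
rewrite /qform mxE exchange_big /=; apply: eq_bigr => j _.
by rewrite !mxE big_distrl.
Qed.

Lemma sqnE {R : realType} {n} (x : 'rV[R]_n) : sqn x = \sum_i x 0 i ^+ 2.
Proof. by rewrite /sqn mxE; apply: eq_bigr => i _; rewrite mxE expr2. Qed.

Lemma sqn_ge0 {R : realType} {n} (x : 'rV[R]_n) : 0 <= sqn x.
Proof. by rewrite sqnE; apply: sumr_ge0 => i _; exact: sqr_ge0. Qed.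

Lemma sqn_eq0 {R : realType} {n} (x : 'rV[R]_n) : (sqn x == 0) = (x == 0).
Proof.
apply/eqP/eqP => [|->]; last by rewrite /sqn mul0mx mxE.
rewrite sqnE => /eqP; rewrite psumr_eq0 => [/allP x0|i _]; last exact: sqr_ge0.
apply/rowP => i; apply/eqP; rewrite mxE -sqrf_eq0.
by apply: x0; rewrite mem_index_enum.
Qed.

Lemma sqn_gt0 {R : realType} {n} (x : 'rV[R]_n) : (0 < sqn x) = (x != 0).
Proof. by rewrite lt_neqAle sqn_ge0 andbT eq_sym sqn_eq0. Qed.

Lemma qformZ {R : realType} {n} (M : 'M[R]_n) c (x : 'rV[R]_n) :
  qform M (c *: x) = c ^+ 2 * qform M x.
Proof.
by rewrite /qform linearZ /= -!scalemxAl -scalemxAr scalerA mxE expr2.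
Qed.

Lemma sqnZ {R : realType} {n} c (x : 'rV[R]_n) : sqn (c *: x) = c ^+ 2 * sqn x.
Proof. by rewrite /sqn linearZ /= -!scalemxAl -scalemxAr scalerA mxE expr2. Qed.

Lemma qform_eigen {R : realType} {n} (M : 'M[R]_n) (x : 'rV[R]_n) a :
  x *m M = a *: x -> qform M x = a * sqn x.
Proof. by rewrite /qform => ->; rewrite -scalemxAl mxE. Qed.

(** Each product [x_i x_j] is at most |x|^2 in absolute value, so the sum of the absolute values of
    the entries is a bound. The added 1 keeps [C] positive even when [M] is zero, so that it can be
    inverted. *)
Lemma qform_bound {R : realType} {n} (M : 'M[R]_n) :
  exists2 C, 0 < C & forall x, qform M x <= C * sqn x.
Proof.
exists (1 + \sum_i \sum_j `|M i j|) => [|x].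
  by rewrite ltr_pwDl// !sumr_ge0// => i _; rewrite sumr_ge0.
apply: (@le_trans _ _ ((\sum_i \sum_j `|M i j|) * sqn x)); last first.
  by rewrite ler_wpM2r ?sqn_ge0// lerDr.
rewrite qformE mulr_suml; apply: ler_sum => i _.
rewrite mulr_suml; apply: ler_sum => j _.
have xs k : x 0 k ^+ 2 <= sqn x.
  by rewrite sqnE (bigD1 k)//= lerDl sumr_ge0// => l _; exact: sqr_ge0.
have -> : x 0 i * M i j * x 0 j = M i j * (x 0 i * x 0 j) by ring.
apply: (le_trans (ler_norm _)); rewrite normrM; apply: ler_wpM2l => //.
rewrite ler_norml; have := xs i; have := xs j => xj xi.
by apply/andP; split; have := sqr_ge0 (x 0 i + x 0 j);
  have := sqr_ge0 (x 0 i - x 0 j); lra.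
Qed.

Lemma qformD {R : realType} {n} (M : 'M[R]_n) (x y : 'rV[R]_n) : M^T = M ->
  qform M (x + y) = qform M x + 2 * (x *m M *m y^T) 0 0 + qform M y.
Proof.
move=> sM; have e : (y *m M *m x^T) 0 0 = (x *m M *m y^T) 0 0.
  have -> : y *m M *m x^T = (x *m M *m y^T)^T.
    by rewrite !trmx_mul trmxK sM mulmxA.
  by rewrite mxE.
rewrite /qform linearD /= !mulmxDl !mulmxDr.
by move: e; rewrite !mxE => ->; ring.
Qed.

(* With y = x P, t = -1/C and C a bound of the form, nonnegativity of the form at x + t y gives
   |x P|^2 <= C (x P x^T), and |x| is controlled by |x P|. *)
Lemma psd_unit_coercive {R : realType} {n} (P : 'M[R]_n) :
  P^T = P -> (forall x, 0 <= qform P x) -> P \in unitmx ->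
  exists2 e, 0 < e & forall x, e * sqn x <= qform P x.
Proof.
move=> sP P0 uP.
have [C C0 hC] := qform_bound P.
have [C' C'0 hC'] := qform_bound (invmx P *m (invmx P)^T).
exists (C * C')^-1 => [|x]; first by rewrite invr_gt0 mulr_gt0.
have h1 : sqn (x *m P) <= C * qform P x.
  have := P0 (x + (- C^-1) *: (x *m P)).
  rewrite qformD// linearZ /= qformZ -scalemxAr mxE -/(sqn (x *m P)) => h.
  have := hC (x *m P) => h'.
  have : C^-1 ^+ 2 * qform P (x *m P) <= C^-1 * sqn (x *m P).
    rewrite expr2 -mulrA ler_pM2l ?invr_gt0// mulrC ler_pdivrMr// mulrC//.
  have : 0 < C^-1 by rewrite invr_gt0.
  move: h; rewrite sqrrN; set u := C^-1 => h u0 h2.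
  rewrite -(ler_pM2l u0) mulrA mulVf ?gt_eqF// mul1r; lra.
(* The form of [P^-1 P^-T] at [x P] is |x|^2, which is what [C'] bounds. *)
have h2 : sqn x <= C' * sqn (x *m P).
  apply: le_trans (hC' (x *m P)).
  by rewrite /qform /sqn !mulmxA mulmxK// -mulmxA -!trmx_mul mulmxK.
rewrite mulrC ler_pdivrMr ?mulr_gt0//; apply: (le_trans h2).
have -> : qform P x * (C * C') = C' * (C * qform P x) by ring.
by rewrite ler_pM2l.
Qed.

Lemma exists_unit_row {R : realType} {n} : (0 < n)%N -> exists x : 'rV[R]_n, sqn x = 1.
Proof.
case: n => // n _; exists (delta_mx 0 0).
rewrite sqnE (bigD1 ord0)//= big1 ?addr0 => [|i i0].
  by rewrite mxE eqxx expr1n.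
by rewrite mxE (negPf i0) andbF expr0n.
Qed.

(* The supremum [s] of the form on the unit sphere is an eigenvalue: otherwise
   [s%:M - M] would be invertible, hence coercive, and [s] not a supremum. *)
Lemma eigenvalue_lam_max {R : realType} {n} (M : 'M[R]_n) : (0 < n)%N ->
  M^T = M ->
  eigenvalue M (lam_max M) /\ forall x, qform M x <= lam_max M * sqn x.
Proof.
move=> n0 sM.
pose S := [set qform M x | x in [set x : 'rV[R]_n | sqn x = 1]].
have [C C0 hC] := qform_bound M.
have supS : has_sup S.
  split; first by have [x x1] := @exists_unit_row R n n0; exists (qform M x), x.
  by exists C => _ [x /= x1 <-]; rewrite -[C]mulr1 -x1.
pose s := sup S.
have hs x : qform M x <= s * sqn x.
  have [->|x0] := eqVneq x 0; first by rewrite /qform /sqn !mul0mx !mxE mulr0.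
  have sx : 0 < sqn x by rewrite sqn_gt0.
  have : S (qform M ((Num.sqrt (sqn x))^-1 *: x)).
    exists ((Num.sqrt (sqn x))^-1 *: x) => //=.
    by rewrite sqnZ exprVn sqr_sqrtr ?sqn_ge0// mulVf ?gt_eqF.
  move=> /(ub_le_sup supS.2); rewrite qformZ exprVn sqr_sqrtr ?sqn_ge0//.
  by rewrite mulrC ler_pdivrMr.
pose P := s%:M - M.
have qP x : qform P x = s * sqn x - qform M x.
  rewrite /qform mulmxBr mulmxBl mul_mx_scalar -scalemxAl mxE.
  by rewrite [X in X + _]mxE [X in _ + X]mxE.
have sP : P^T = P by rewrite /P linearB /= tr_scalar_mx sM.
have Peig : eigenvalue M s.
  have [uP|nuP] := boolP (P \in unitmx).
    have [x|e e0 he] := psd_unit_coercive P sP _ uP.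
      by rewrite qP subr_ge0.
    suff : s <= s - e by lra.
    apply: ge_sup; first by case: supS.
    move=> _ [x /= x1 <-].
    by have := he x; rewrite qP x1; lra.
  move: nuP; rewrite unitmxE unitfE negbK => /det0P[v v0 vP].
  apply/eigenvalueP; exists v => //.
  by apply/esym/eqP; rewrite -subr_eq0 -mul_mx_scalar -mulmxBr vP.
suff -> : lam_max M = s by [].
apply/eqP; rewrite eq_le /lam_max; apply/andP; split.
  apply: ge_sup; first by exists s.
  move=> a /eigenvalueP[v vM v0].
  by have := hs v; rewrite (qform_eigen _ _ _ vM) ler_pM2r// sqn_gt0.
apply: ub_le_sup => //; exists s => a /eigenvalueP[v vM v0].
by have := hs v; rewrite (qform_eigen _ _ _ vM) ler_pM2r// sqn_gt0.
Qed.

(** Reduction to the largest eigenvalue of [- M]: negation reverses the spectrum, and [inf] unfolds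
    to minus the [sup] of the negated set. *)
Lemma eigenvalue_lam_min {R : realType} {n} (M : 'M[R]_n) : (0 < n)%N ->
  M^T = M ->
  eigenvalue M (lam_min M) /\ forall x, lam_min M * sqn x <= qform M x.
Proof.
move=> n0 sM.
have eigN a : eigenvalue (- M) a -> eigenvalue M (- a).
  move=> /eigenvalueP[v vM v0]; apply/eigenvalueP; exists v => //.
  by rewrite scaleNr -vM mulmxN opprK.
have sNM : (- M)^T = - M by rewrite linearN /= sM.
have [e1 e2] := eigenvalue_lam_max (- M) n0 sNM.
have -> : lam_min M = - lam_max (- M).
  rewrite /lam_min /inf; congr (- sup _); apply/seteqP; split => a /=.
    move=> [b eb <-]; apply/eigenvalueP; case/eigenvalueP: eb => v vM v0.
    by exists v => //; rewrite mulmxN vM scaleNr.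
  by move=> ea; exists (- a); [exact: eigN|rewrite opprK].
split; first exact: eigN.
move=> x; have := e2 x; rewrite {1}/qform mulmxN mulNmx mxE -/(qform M x).
by rewrite mulNr; lra.
Qed.

(** The extreme eigenvalue is attained, so the bound need only be tested at an eigenvector. *)
Lemma lam_maxP {R : realType} {n} (M : 'M[R]_n) c : (0 < n)%N -> M^T = M ->
  (forall x, qform M x <= c * sqn x) -> lam_max M <= c.
Proof.
move=> n0 sM hc; have [/eigenvalueP[v vM v0] _] := eigenvalue_lam_max M n0 sM.
by have := hc v; rewrite (qform_eigen _ _ _ vM) ler_pM2r// sqn_gt0.
Qed.

Lemma lam_minP {R : realType} {n} (M : 'M[R]_n) c : (0 < n)%N -> M^T = M ->
  (forall x, c * sqn x <= qform M x) -> c <= lam_min M.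
Proof.
move=> n0 sM hc; have [/eigenvalueP[v vM v0] _] := eigenvalue_lam_min M n0 sM.
by have := hc v; rewrite (qform_eigen _ _ _ vM) ler_pM2r// sqn_gt0.
Qed.

Lemma lam_min_le_max {R : realType} {n} (M : 'M[R]_n) : (0 < n)%N -> M^T = M ->
  lam_min M <= lam_max M.
Proof.
move=> n0 sM; have [x x1] := @exists_unit_row R n n0.
have [_ /(_ x)] := eigenvalue_lam_min M n0 sM.
have [_ /(_ x)] := eigenvalue_lam_max M n0 sM.
by rewrite x1 !mulr1 => h1 h2; exact: le_trans h2 h1.
Qed.

Lemma lam_min_gt0 {R : realType} {n} (M : 'M[R]_n) : (0 < n)%N -> M^T = M ->
  (forall x, x != 0 -> 0 < qform M x) -> 0 < lam_min M.
Proof.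
move=> n0 sM hM; have [/eigenvalueP[v vM v0] _] := eigenvalue_lam_min M n0 sM.
by have := hM _ v0; rewrite (qform_eigen _ _ _ vM) pmulr_lgt0// sqn_gt0.
Qed.

(** * Diagonal scaling and block matrices *)

Definition dscale {R : realType} {n} (M : 'M[R]_n) (x : 'rV[R]_n) : 'rV[R]_n :=
  \row_i (x 0 i / Num.sqrt (M i i)).

Lemma qform_scaled {R : realType} {n} (M : 'M[R]_n) (x : 'rV[R]_n) :
  qform (scaled M) x = qform M (dscale M x).
Proof.
rewrite /qform /scaled /=; set D := diag_mx _.
have -> : dscale M x = x *m D.
  by rewrite mul_mx_diag; apply/rowP => i; rewrite !mxE.
by rewrite trmx_mul tr_diag_mx !mulmxA.
Qed.

Lemma scaled_tr {R : realType} {n} (M : 'M[R]_n) :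
  M^T = M -> (scaled M)^T = scaled M.
Proof. by move=> sM; rewrite /scaled !trmx_mul sM tr_diag_mx mulmxA. Qed.

(** The diagonal of [M] is made of the diagonals of its two diagonal blocks, so scaling does not mix
    the blocks. *)
Lemma dscale_row_mx {R : realType} {m n} (M : 'M[R]_(m + n)) y z :
  dscale M (row_mx y z) = row_mx (dscale (ulsubmx M) y) (dscale (drsubmx M) z).
Proof.
apply/rowP => i; rewrite -(splitK i); case: (fintype.split i) => j /=.
  by rewrite row_mxEl [LHS]mxE row_mxEl !mxE.
by rewrite row_mxEr [LHS]mxE row_mxEr !mxE.
Qed.

Lemma sqn_row_mx {R : realType} {m n} (y : 'rV[R]_m) (z : 'rV[R]_n) :
  sqn (row_mx y z) = sqn y + sqn z.
Proof. by rewrite /sqn tr_row_mx mul_row_col mxE. Qed.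

Lemma qform_row_mx0 {R : realType} {m n} (M : 'M[R]_(m + n)) (y : 'rV[R]_m) :
  qform M (row_mx y 0) = qform (ulsubmx M) y.
Proof.
rewrite /qform -{1}[M]submxK mul_row_block !mul0mx !addr0.
by rewrite tr_row_mx mul_row_col trmx0 mulmx0 addr0.
Qed.

Lemma qform_diag_gt0 {R : realType} {n} (M : 'M[R]_n) i :
  (forall x, x != 0 -> 0 < qform M x) -> 0 < M i i.
Proof.
move=> h; have : delta_mx 0 i != 0 :> 'rV[R]_n.
  by apply/eqP => /rowP/(_ i)/eqP; rewrite !mxE !eqxx oner_eq0.
move=> /h; rewrite qformE.
rewrite (bigD1 i)//= [X in _ + X]big1 => [|j ji]; last first.
  by rewrite big1// => k _; rewrite mxE (negPf ji) andbF !mul0r.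
rewrite (bigD1 i)//= [X in _ + X + _]big1 => [|j ji]; last first.
  by rewrite [X in _ * X]mxE (negPf ji) andbF mulr0.
by rewrite !mxE !eqxx mul1r mulr1 !addr0.
Qed.

Lemma dscale_neq0 {R : realType} {n} (M : 'M[R]_n) x :
  (forall i, 0 < M i i) -> x != 0 -> dscale M x != 0.
Proof.
move=> M0; apply: contra => /eqP/rowP h; apply/eqP/rowP => i.
have := h i; rewrite !mxE => /eqP; rewrite mulf_eq0 invr_eq0.
by rewrite [_ == 0 :> R in X in _ || X]gt_eqF ?sqrtr_gt0// orbF => /eqP.
Qed.

(** The scaling cancels the diagonal weights: a bound relative to the weighted norm of [z] becomes a
    bound on the spectrum of the scaled matrix. *)
Lemma sqn_dscale {R : realType} {n} (M : 'M[R]_n) x :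
  (forall i, 0 < M i i) -> \sum_i dscale M x 0 i ^+ 2 * M i i = sqn x.
Proof.
move=> M0; rewrite sqnE; apply: eq_bigr => i _.
rewrite mxE expr_div_n sqr_sqrtr ?(ltW (M0 i))//.
by rewrite divfK// gt_eqF.
Qed.

(** The linear algebra of the theorem, free of finite elements. The scaled form at [row_mx y z] lies
    between [L] and [U] times the sum of two decoupled scaled forms, whose spectra lie in
    [[lmin, lmax]] and [[l, u]]. The second block may be empty. *)
Lemma scond_block_bounds {R : realType} {n m} (M : 'M[R]_(n + m)) (L U l u : R) :
  let M1 := ulsubmx M in
  let M2 := drsubmx M in
  (0 < n)%N -> M^T = M -> 0 < L -> 0 < U -> 0 < l -> 0 < u ->
  (forall y, y != 0 -> 0 < qform M1 y) ->
  (forall j, 0 < M2 j j) ->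
  (forall y z, L * (qform M1 y + qform M2 z) <= qform M (row_mx y z) /\
     qform M (row_mx y z) <= U * (qform M1 y + qform M2 z)) ->
  (forall z : 'rV[R]_m, l * (\sum_j z 0 j ^+ 2 * M2 j j) <= qform M2 z /\
     qform M2 z <= u * (\sum_j z 0 j ^+ 2 * M2 j j)) ->
  let lmax := lam_max (scaled M1) in
  let lmin := lam_min (scaled M1) in
  L / U * scond M1 <= scond M /\
  scond M <= scond M1 * (U / L) * (Num.max 1 (u / lmax) / Num.min 1 (l / lmin)).
Proof.
move=> M1 M2 n0 sM L0 U0 l0 u0 pd1 d2 hM h2 lmax lmin.
have nm0 : (0 < n + m)%N by rewrite addn_gt0 n0.
have sM1 : M1^T = M1 by rewrite /M1 trmx_ulsub sM.
have d1 i : 0 < M1 i i by exact: qform_diag_gt0.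
have sS := scaled_tr M sM; have sS1 := scaled_tr M1 sM1.
have [eigmax hmax] := eigenvalue_lam_max _ n0 sS1.
have [eigmin hmin] := eigenvalue_lam_min _ n0 sS1.
have lmin0 : 0 < lmin.
  apply: lam_min_gt0 => // x x0; rewrite qform_scaled.
  by apply: pd1; exact: dscale_neq0.
have lmax0 : 0 < lmax by rewrite (lt_le_trans lmin0)// lam_min_le_max.
have qS y z : qform (scaled M) (row_mx y z) =
    qform M (row_mx (dscale M1 y) (dscale M2 z)).
  by rewrite qform_scaled dscale_row_mx.
have b2 z : l * sqn z <= qform M2 (dscale M2 z) /\
            qform M2 (dscale M2 z) <= u * sqn z.
  by have := h2 (dscale M2 z); rewrite sqn_dscale.
(* Interlacing: vectors [row_mx y 0] realise the form of the scaled [M1] inside that of the scaled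
   [M]. *)
have Lmax : lmax <= lam_max (scaled M).
  have [_ hm] := eigenvalue_lam_max _ nm0 sS.
  apply: lam_maxP => // y; have := hm (row_mx y 0).
  rewrite qform_scaled dscale_row_mx sqn_row_mx.
  have -> : dscale (drsubmx M) 0 = 0 by apply/rowP => i; rewrite !mxE mul0r.
  by rewrite qform_row_mx0 -/M1 -qform_scaled [sqn 0]/sqn mul0mx mxE addr0.
have Lmin : lam_min (scaled M) <= lmin.
  have [_ hm] := eigenvalue_lam_min _ nm0 sS.
  apply: lam_minP => // y; have := hm (row_mx y 0).
  rewrite qform_scaled dscale_row_mx sqn_row_mx.
  have -> : dscale (drsubmx M) 0 = 0 by apply/rowP => i; rewrite !mxE mul0r.
  by rewrite qform_row_mx0 -/M1 -qform_scaled [sqn 0]/sqn mul0mx mxE addr0.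
(* The two blocks are bounded separately, by [lmax] and by [u], and both constants are absorbed in
   their maximum. *)
have Umax : lam_max (scaled M) <= U * Num.max lmax u.
  apply: lam_maxP => // x; rewrite -[x]hsubmxK qS sqn_row_mx.
  apply: (le_trans (hM _ _).2); rewrite -mulrA ler_pM2l// mulrDr lerD//.
    rewrite -qform_scaled; apply: (le_trans (hmax _)).
    by rewrite ler_wpM2r ?sqn_ge0// le_max lexx.
  apply: (le_trans (b2 _).2).
  by rewrite ler_wpM2r ?sqn_ge0// le_max lexx orbT.
have Umin : L * Num.min lmin l <= lam_min (scaled M).
  apply: lam_minP => // x; rewrite -[x]hsubmxK qS sqn_row_mx.
  apply: le_trans (hM _ _).1; rewrite -mulrA ler_pM2l// mulrDr lerD//.
    rewrite -qform_scaled; apply: le_trans (hmin _).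
    by rewrite ler_wpM2r ?sqn_ge0// ge_min lexx.
  apply: le_trans (b2 _).1.
  by rewrite ler_wpM2r ?sqn_ge0// ge_min lexx orbT.
have min0 : 0 < Num.min lmin l by rewrite lt_min lmin0.
have lm0 : 0 < lam_min (scaled M) by rewrite (lt_le_trans _ Umin)// mulr_gt0.
(* At [z = 0] and [y] nonzero, both bounds concern the same positive number [qform M1 y]. *)
have LU : L / U <= 1.
  rewrite ler_pdivrMr// mul1r.
  have [y y1] := @exists_unit_row R n n0.
  have y0 : y != 0 by rewrite -sqn_gt0 y1.
  have q0 : qform M2 0 = 0 by rewrite /qform !mul0mx mxE.
  have := hM y 0; rewrite q0 addr0 => -[a b].
  by have := le_trans a b; rewrite ler_pM2r// pd1.
split.
  apply: (@le_trans _ _ (scond M1)).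
    by rewrite ler_piMl// /scond divr_ge0// ltW.
  rewrite /scond ler_pM ?invr_ge0 ?(ltW lmax0) ?(ltW lmin0)//.
  by rewrite lef_pV2.
(* Clearing [lmax] and [lmin] from the maximum and minimum cancels the factor [scond M1], leaving
   the quotient of the bounds [Umax] and [Umin]. *)
have -> : Num.max 1 (u / lmax) = Num.max lmax u / lmax.
  by rewrite -[X in Num.max X](divff (lt0r_neq0 lmax0)) -maxr_pMl ?invr_ge0 ?ltW.
have -> : Num.min 1 (l / lmin) = Num.min lmin l / lmin.
  by rewrite -[X in Num.min X](divff (lt0r_neq0 lmin0)) -minr_pMl ?invr_ge0 ?ltW.
rewrite /scond -/lmax -/lmin.
have -> : lmax / lmin * (U / L) *
    (Num.max lmax u / lmax / (Num.min lmin l / lmin)) =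
    (U * Num.max lmax u) / (L * Num.min lmin l).
  by field; rewrite !gt_eqF.
rewrite ler_pM ?invr_ge0 ?(ltW lm0)//.
  exact: le_trans (ltW lmax0) Lmax.
by rewrite lef_pV2// ?posrE// mulr_gt0.
Qed.

(** * Square integrable functions *)

(** Measurability of [f] is a separate clause, since it does not follow from that of its square. *)
Definition sqint {R : realType} (D : set R) (f : R -> R) : Prop :=
  measurable_fun D f /\
  (@lebesgue_measure R).-integrable D (fun x => (f x ^+ 2)%:E).

(** Domination by [C (f^2 + g^2)]. The weight [w] is the coefficient [a] in the energy form, and a
    constant or a square elsewhere. *)
Lemma sqint_integrable_mul {R : realType} (D : set R) (w f g : R -> R) C :
  measurable D -> measurable_fun D w -> (forall x, D x -> `|w x| <= C) ->
  sqint D f -> sqint D g ->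
  (@lebesgue_measure R).-integrable D (fun x => (w x * f x * g x)%:E).
Proof.
move=> mD mw hC [mf if2] [mg ig2].
have ib : (@lebesgue_measure R).-integrable D
    (fun x => (C%:E * ((f x ^+ 2)%:E + (g x ^+ 2)%:E))%E).
  by apply: integrableZl => //; exact: integrableD.
apply: le_integrable ib => //.
  apply/measurable_EFinP; apply: measurable_funM => //.
  exact: measurable_funM.
move=> x Dx; rewrite -EFinD -EFinM !abse_EFin lee_fin.
apply: le_trans (ler_norm _); rewrite -mulrA normrM.
apply: ler_pM => //; first exact: hC.
rewrite ler_norml; apply/andP; split;
  have := sqr_ge0 (f x - g x); have := sqr_ge0 (f x + g x);
  have := sqr_ge0 (f x); have := sqr_ge0 (g x); lra.
Qed.

Lemma sqint_mul_bounded {R : realType} (D : set R) (w f : R -> R) C :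
  measurable D -> measurable_fun D w -> (forall x, D x -> `|w x| <= C) ->
  sqint D f -> sqint D (fun x => w x * f x).
Proof.
move=> mD mw hC sf; split; first by apply: measurable_funM => //; exact: sf.1.
have h : forall x, D x -> `|w x ^+ 2| <= C ^+ 2.
  move=> x Dx; rewrite normrX ler_sqr ?nnegrE//; first exact: hC.
  exact: le_trans (hC _ Dx).
have mw2 : measurable_fun D (fun x => w x ^+ 2) by exact: measurable_funX.
apply: eq_integrable (sqint_integrable_mul D _ f f _ mD mw2 h sf sf) => // x _.
by congr (_%:E); ring.
Qed.

Lemma sqintZ {R : realType} (D : set R) c (f : R -> R) :
  measurable D -> sqint D f -> sqint D (fun x => c * f x).
Proof. by move=> mD; apply: (@sqint_mul_bounded _ _ (cst c) _ `|c|). Qed.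

(** Expanding the square leaves a cross term, integrable as a product with the constant weight 2. *)
Lemma sqintD {R : realType} (D : set R) (f g : R -> R) :
  measurable D -> sqint D f -> sqint D g -> sqint D (fun x => f x + g x).
Proof.
move=> mD sf sg; split.
  by apply: measurable_funD; [exact: sf.1|exact: sg.1].
have ifg : (@lebesgue_measure R).-integrable D (fun x => (2 * f x * g x)%:E).
  by apply: (@sqint_integrable_mul _ _ (cst 2) f g 2) => // x _; rewrite ger0_norm.
have : (@lebesgue_measure R).-integrable D
    (fun x => ((f x ^+ 2)%:E + (2 * f x * g x)%:E + (g x ^+ 2)%:E)%E).
  apply: integrableD => //; last exact: sg.2.
  by apply: integrableD => //; exact: sf.2.
apply: eq_integrable => // x _ /=.
by rewrite -!EFinD; congr (_%:E); ring.
Qed.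

Lemma sqint_bounded {R : realType} (D : set R) (f : R -> R) C :
  measurable D -> (lebesgue_measure D < +oo)%E ->
  measurable_fun D f -> (forall x, D x -> `|f x| <= C) -> sqint D f.
Proof.
move=> mD Doo mf hC; split => //.
apply: (@measurable_bounded_integrable _ _ _ (@lebesgue_measure R)
  (fun x => f x ^+ 2) D) => //; first exact: measurable_funX.
exists (C ^+ 2); split; first exact: num_real.
move=> y Cy x Dx; rewrite /= normrX; apply/ltW/(le_lt_trans _ Cy).
rewrite ler_sqr ?nnegrE//; first exact: hC.
exact: le_trans (hC _ Dx).
Qed.

Lemma sqint_sum {R : realType} (D : set R) (I : Type) (r : seq I)
  (f : I -> R -> R) : measurable D -> (forall i, sqint D (f i)) ->
  sqint D (fun x => \sum_(i <- r) f i x).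
Proof.
move=> mD sf; elim: r => [|i r IH].
  have -> : (fun x => \sum_(j <- [::]) f j x) = cst (0 : R).
    by apply/funext => x; rewrite big_nil.
  split; first exact: measurable_cst.
  by rewrite /= expr0n; exact: integrable0.
under eq_fun do rewrite big_cons.
exact: sqintD.
Qed.

(** On a set of finite measure, pairing [f] with the constant 1 embeds L^2 in L^1. *)
Lemma sqint_integrable {R : realType} (D : set R) (f : R -> R) :
  measurable D -> (lebesgue_measure D < +oo)%E -> sqint D f ->
  (@lebesgue_measure R).-integrable D (EFin \o f).
Proof.
move=> mD Doo sf.
have s1 : sqint D (cst (1 : R)).
  by apply: (@sqint_bounded _ _ _ 1) => // x _; rewrite /= normr1.
apply: eq_integrable (sqint_integrable_mul D (cst 1) f (cst 1) 1 mD _ _ sf s1) => //=.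
  by move=> x _; rewrite mul1r mulr1.
by move=> x _; rewrite normr1.
Qed.

(* Lebesgue differentiation of the primitive. *)
Lemma ae_cst_of_affine_integral {R : realType} (f : R -> R) (p q s t b c : R) :
  (@lebesgue_measure R).-integrable `[p, q] (EFin \o f) ->
  p <= s -> t <= q ->
  (forall x, s < x < t ->
    \int[lebesgue_measure]_(u in `[p, x]) f u = b + c * x) ->
  {ae (@lebesgue_measure R), forall x, s < x < t -> f x = c}.
Proof.
move=> intf ps tq hF.
(* Extension by zero makes [f] locally integrable on the whole line, as [FTC1] requires. *)
pose g := f \_ `[p, q].
have ig : (@lebesgue_measure R).-integrable setT (EFin \o g).
  by move: intf; rewrite integrable_mkcond// restrict_EFin.
have lg : locally_integrable setT g.
  by apply: open_integrable_locally => //; exact: openT.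
have igy y : (@lebesgue_measure R).-integrable
    [set` Interval (BLeft p) (BRight y)] (EFin \o g).
  exact: integrableS ig.
have := @FTC1 _ g (BLeft p) igy lg.
apply: filterS; first exact: (ae_filter_ringOfSetsType lebesgue_measure).
move=> x /= h /andP[sx xt].
have -> : f x = g x.
  by rewrite /g patchE mem_set//= in_itv/= (ltW (le_lt_trans ps sx))
    (ltW (lt_le_trans xt tq)).
have {h} [|_ <-] := h; first by rewrite lte_fin (le_lt_trans ps).
have : is_derive x 1 (fun y : R => b + c * y) c.
  have h1 : is_derive x 1 (fun y : R => b + c *: (y : R^o)) (0 + c *: 1).
    by apply: is_deriveD.
  have e1 : 0 + c *: (1 : R^o) = c by rewrite add0r; exact: mulr1.
  by rewrite -[X in is_derive _ _ _ X]e1; exact: h1.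
move=> [_ <-]; rewrite derive1E; apply: near_eq_derive.
(* A derivative depends only on nearby values, and near [x] the primitive is the affine function of
   [hF]. *)
near=> y.
have yst : s < y < t by near: y; apply: near_in_itvoo; rewrite in_itv/= sx xt.
rewrite -hF//; apply: eq_Rintegral => u; rewrite inE/= in_itv/= => /andP[pu uy].
rewrite /g patchE mem_set//= in_itv/= pu (le_trans uy)//.
by case/andP: yst => _ /ltW/le_trans; apply.
Unshelve. all: by end_near. Qed.

(** Bridges the two halves of [inH1]: integrability is given on the open patch, while the primitive
    is taken over closed intervals. *)
Lemma integrable_itv_oo_cc {R : realType} (f : R -> R) p q :
  (@lebesgue_measure R).-integrable `]p, q[ (EFin \o f) ->
  (@lebesgue_measure R).-integrable `[p, q] (EFin \o f).
Proof.
move=> /integrableP[/measurable_EFinP mf fi]; apply/integrableP; split.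
  by apply/measurable_EFinP; exact: measurable_fun_itv_cc mf.
by rewrite integral_itv_bndoo//; do 2 apply: measurableT_comp => //.
Qed.

(** * The energy form on the enriched space *)

Section EnrichedSpace.
Context {R : realType} (N : nat) (a : R -> R) (alpha beta : R).
Context (phi dphi : nat -> R -> R).
Hypothesis N_gt0 : (0 < N)%N.
Hypothesis alpha_gt0 : 0 < alpha.
Hypothesis a_meas : measurable_fun (`]0, 1[ : set R) a.
Hypothesis a_bounds : forall x, 0 < x < 1 -> alpha <= a x <= beta.
Hypothesis phi_H1 : forall i, (i <= N)%N -> inH1 N phi dphi i.

(** Elements are taken open because the hypotheses on [a] hold only inside []0, 1[]; [Bel]
    integrates over the closed element, and [BelE] discards the endpoints. *)
Local Notation el k := (`]xn R N k.-1, xn R N k[%classic : set R).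
Local Notation leb := (@lebesgue_measure R).

(** * Mesh points and the coefficient on an element *)

Lemma hh_gt0 : 0 < hh R N.
Proof. by rewrite invr_gt0 ltr0n. Qed.

Lemma xn_pred k : (0 < k)%N -> xn R N k = xn R N k.-1 + hh R N.
Proof. by case: k => // k _; rewrite /xn /hh -natr1 mulrDl mul1r. Qed.

Lemma xn_le j k : (j <= k)%N -> xn R N j <= xn R N k.
Proof. by move=> jk; rewrite ler_wpM2r ?invr_ge0// ler_nat. Qed.

Lemma xn0 : xn R N 0 = 0.
Proof. by rewrite /xn mul0r. Qed.

Lemma xnN : xn R N N = 1.
Proof. by rewrite /xn divff// pnatr_eq0 -lt0n. Qed.

Lemma xn_lt k : valid_el N k -> xn R N k.-1 < xn R N k.
Proof. by case/andP => k0 _; rewrite [ltRHS]xn_pred// ltrDl hh_gt0. Qed.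

Lemma el_sub01 k x : valid_el N k -> el k x -> 0 < x < 1.
Proof.
case/andP => k0 kN; rewrite /= in_itv/= => /andP[x1 x2].
rewrite (le_lt_trans _ x1) -?xn0 ?xn_le//=.
by rewrite (lt_le_trans x2)// -xnN xn_le.
Qed.

Lemma a_meas_el k : valid_el N k -> measurable_fun (el k) a.
Proof.
move=> vk; apply: measurable_funS a_meas => // x /(el_sub01 _ _ vk).
by rewrite /= in_itv.
Qed.

Lemma a_norm_el k x : valid_el N k -> el k x -> `|a x| <= beta.
Proof.
move=> vk /(el_sub01 _ _ vk)/a_bounds/andP[a1 a2].
by rewrite ger0_norm// (le_trans _ a1)// ltW.
Qed.

Lemma el_fin k : (leb (el k) < +oo)%E.
Proof.
by rewrite lebesgue_measure_itv /=; case: ifP => // _; rewrite -EFinD ltry.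
Qed.

(** * Bilinearity and positivity of the element forms *)

Lemma Bel_integrable k u v : valid_el N k -> sqint (el k) u -> sqint (el k) v ->
  leb.-integrable (el k) (EFin \o (fun x => a x * u x * v x)).
Proof.
move=> vk; apply: (@sqint_integrable_mul _ _ a u v beta) => //.
  exact: a_meas_el.
by move=> x; exact: a_norm_el.
Qed.

Lemma BelE k u v : valid_el N k -> sqint (el k) u -> sqint (el k) v ->
  Bel N a k u v = \int[leb]_(x in el k) (a x * u x * v x).
Proof.
move=> vk su sv; rewrite /Bel /mu /Rintegral integral_itv_bndoo//.
exact: measurable_int (Bel_integrable _ _ _ vk su sv).
Qed.

Lemma BelC k u v : Bel N a k u v = Bel N a k v u.
Proof.
by rewrite /Bel; congr fine; apply: eq_integral => x _; congr (_%:E); ring.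
Qed.

Lemma BelZl k c u v : valid_el N k -> sqint (el k) u -> sqint (el k) v ->
  Bel N a k (fun x => c * u x) v = c * Bel N a k u v.
Proof.
move=> vk su sv; rewrite !BelE//; last exact: sqintZ.
rewrite -RintegralZl//; last exact: Bel_integrable.
by apply: eq_Rintegral => x _; ring.
Qed.

Lemma BelDl k u u' v : valid_el N k -> sqint (el k) u -> sqint (el k) u' ->
  sqint (el k) v ->
  Bel N a k (fun x => u x + u' x) v = Bel N a k u v + Bel N a k u' v.
Proof.
move=> vk su su' sv; rewrite !BelE//; last exact: sqintD.
rewrite -RintegralD//; [|exact: Bel_integrable|exact: Bel_integrable].
by apply: eq_Rintegral => x _; ring.
Qed.

Lemma Bel_suml k (I : Type) (r : seq I) (c : I -> R) (u : I -> R -> R) v :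
  valid_el N k -> (forall i, sqint (el k) (u i)) -> sqint (el k) v ->
  Bel N a k (fun x => \sum_(i <- r) c i * u i x) v =
  \sum_(i <- r) c i * Bel N a k (u i) v.
Proof.
move=> vk su sv; elim: r => [|i r IH].
  rewrite big_nil /Bel integral0_eq// => x _.
  by rewrite big_nil mulr0 mul0r.
rewrite big_cons -IH -BelZl// -BelDl//; first 1 last.
- exact: sqintZ.
- by apply: sqint_sum => // j; exact: sqintZ.
by congr Bel; apply/funext => x; rewrite big_cons.
Qed.

Lemma Bel_sum k (I J : Type) (r : seq I) (s : seq J) (c : I -> R) (d : J -> R)
    (u : I -> R -> R) (v : J -> R -> R) :
  valid_el N k -> (forall i, sqint (el k) (u i)) ->
  (forall j, sqint (el k) (v j)) ->
  Bel N a k (fun x => \sum_(i <- r) c i * u i x) (fun x => \sum_(j <- s) d j * v j x) =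
  \sum_(i <- r) \sum_(j <- s) c i * Bel N a k (u i) (v j) * d j.
Proof.
move=> vk su sv; rewrite Bel_suml//; last first.
  by apply: sqint_sum => // j; exact: sqintZ.
apply: eq_bigr => i _; rewrite BelC Bel_suml// mulr_sumr.
by apply: eq_bigr => j _; rewrite BelC; ring.
Qed.

Lemma Bel_ge0 k u : valid_el N k -> sqint (el k) u -> 0 <= Bel N a k u u.
Proof.
move=> vk su; rewrite BelE//; apply: Rintegral_ge0 => x.
move=> /(el_sub01 _ _ vk)/a_bounds/andP[a1 _].
by rewrite -mulrA -expr2 mulr_ge0 ?sqr_ge0// (le_trans _ a1)// ltW.
Qed.

(* The form at [t u + v] is affine in [t] and nonnegative, so its slope vanishes. *)
Lemma Bel_null k u v : valid_el N k -> sqint (el k) u -> sqint (el k) v ->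
  Bel N a k u u = 0 -> Bel N a k u v = 0.
Proof.
move=> vk su sv u0; apply/eqP/negPn/negP => b0.
set b := Bel N a k u v in b0.
(* With this [t] the form at [t u + v] equals [2 t b + B(v, v) = -1], contradicting
   nonnegativity. *)
pose t := - (Bel N a k v v + 1) / (2 * b).
have st : sqint (el k) (fun x => t * u x) by exact: sqintZ.
have := Bel_ge0 k (fun x => t * u x + v x) vk (sqintD _ _ _ (measurable_itv _) st sv).
rewrite BelDl//; last exact: sqintD.
rewrite BelZl//; last exact: sqintD.
rewrite (BelC k u) (BelC k v) !BelDl// !BelZl// u0 (BelC k v u) -/b.
rewrite mulr0 add0r.
have -> : t * b = - (Bel N a k v v + 1) / 2 by rewrite /t; field.
lra.
Qed.

Lemma Bel_ae0 k u v : valid_el N k -> sqint (el k) u -> sqint (el k) v ->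
  {ae leb, forall x, el k x -> u x = 0} -> Bel N a k u v = 0.
Proof.
move=> vk su sv u0; rewrite BelE//.
rewrite /Rintegral (ae_eq_integral (cst 0%E)) ?integral0//.
  exact: measurable_int (Bel_integrable _ _ _ vk su sv).
move: u0; apply: filterS; first exact: (ae_filter_ringOfSetsType leb).
move=> x ux /ux -> /=.
by rewrite mulr0 mul0r.
Qed.

Lemma sqint_cst k (c : R) : sqint (el k) (cst c).
Proof. by apply: (@sqint_bounded _ _ _ `|c|) => //; exact: el_fin. Qed.

(** Functions of S_1 have constant derivative on each element; there [a >= alpha] and the length is
    [hh]. *)
Lemma Bel_cst_ge k (c : R) : valid_el N k ->
  alpha * hh R N * c ^+ 2 <= Bel N a k (cst c) (cst c).
Proof.
move=> vk; have sc := sqint_cst k c.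
rewrite BelE//; apply: (@le_trans _ _ (\int[leb]_(x in el k) (alpha * c ^+ 2))).
  rewrite Rintegral_cst//= lebesgue_measure_itv/= lte_fin xn_lt//=.
  case/andP: vk => k0 _; rewrite xn_pred// addrAC subrr add0r.
  by rewrite mulrAC lexx.
apply: le_Rintegral => //.
- apply: (@measurable_bounded_integrable _ _ _ leb (cst (alpha * c ^+ 2))) => //.
    exact: el_fin.
  exists `|alpha * c ^+ 2|; split; first exact: num_real.
  by move=> y /ltW cy x _.
- exact: Bel_integrable.
move=> x /(el_sub01 _ _ vk)/a_bounds/andP[a1 _] /=.
by rewrite -mulrA -expr2 ler_wpM2r// sqr_ge0.
Qed.

Lemma Bform_sum (I J : finType) (c : I -> R) (d : J -> R)
    (u : I -> nat -> R -> R) (v : J -> nat -> R -> R) :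
  (forall i k, valid_el N k -> sqint (el k) (u i k)) ->
  (forall j k, valid_el N k -> sqint (el k) (v j k)) ->
  Bform N a (fun k x => \sum_i c i * u i k x) (fun k x => \sum_j d j * v j k x) =
  \sum_i \sum_j c i * Bform N a (u i) (v j) * d j.
Proof.
move=> su sv; rewrite /Bform.
transitivity (\sum_(1 <= k < N.+1) \sum_i \sum_j
    c i * Bel N a k (u i k) (v j k) * d j).
  apply: eq_big_nat => k vk; apply: Bel_sum => // [i|j]; [exact: su|exact: sv].
rewrite exchange_big /=; apply: eq_bigr => i _.
rewrite exchange_big /=; apply: eq_bigr => j _.
by rewrite mulr_sumr mulr_suml.
Qed.

Lemma BformC u v : Bform N a u v = Bform N a v u.
Proof. by apply: eq_bigr => k _; exact: BelC. Qed.

Lemma Bform_ge0 v : (forall k, valid_el N k -> sqint (el k) (v k)) ->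
  0 <= Bform N a v v.
Proof.
move=> sv; rewrite /Bform big_nat sumr_ge0// => k vk.
by apply: Bel_ge0 => //; exact: sv.
Qed.

(** Zero energy makes the derivative vanish on every element. The coefficients then vanish one after
    the other from the left, starting at [x_0], where functions of S_1 are zero. *)
Lemma dS1_pos (c : 'I_N -> R) : Bform N a (dS1 c) (dS1 c) = 0 -> forall i, c i = 0.
Proof.
move=> B0.
have w0 (k : nat) : valid_el N k -> \sum_(i < N) c i * dNhat R N i.+1 k = 0.
  move=> vk.
  move: B0 => /eqP; rewrite /Bform big_nat psumr_eq0 => [/allP B0|j vj]; last first.
    by apply: Bel_ge0 => //; exact: sqint_cst.
  have /B0/implyP/(_ vk)/eqP Bk : k \in index_iota 1 N.+1 by rewrite mem_index_iota.
  have := Bel_cst_ge k (\sum_(i < N) c i * dNhat R N i.+1 k) vk.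
  have -> : cst (\sum_(i < N) c i * dNhat R N i.+1 k) = dS1 c k by [].
  rewrite Bk => h; apply/eqP; rewrite -sqrf_eq0 eq_le sqr_ge0 andbT.
  by move: h; rewrite pmulr_rle0// mulr_gt0// hh_gt0.
have hN0 : (hh R N)^-1 != 0 by rewrite invr_eq0 gt_eqF// hh_gt0.
suff : forall n (i : 'I_N), (i < n)%N -> c i = 0 by move=> h i; exact: (h i.+1).
elim=> // n IH i; rewrite ltnS leq_eqVlt => /orP[/eqP iE|]; last exact: IH.
(* [c i] multiplies the hat function of node [i.+1]. On element [i.+1] only the hats of nodes [i]
   and [i.+1] have a slope, and the coefficient of the former is already zero. *)
have := w0 i.+1 (ltn_ord i); rewrite (bigD1 i)//= big1 => [|j ji].
  by rewrite /dNhat eqxx addr0 => /eqP; rewrite mulf_eq0 (negPf hN0) orbF => /eqP.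
have [jn|] := ltnP j n; first by rewrite IH// mul0r.
rewrite leq_eqVlt -iE => /orP[/eqP ij|ij].
  by move: ji; rewrite -(inj_eq val_inj)/= ij eqxx.
rewrite /dNhat eqSS ltn_eqF// eqSS ltn_eqF ?mulr0//.
exact: ltn_trans ij _.
Qed.

(** * Square integrability of the enrichment derivatives *)

Lemma patch_el i k : (i <= N)%N -> valid_el N k -> (k == i) || (k == i.+1) ->
  plo R N i <= xn R N k.-1 /\ xn R N k <= phi_hi R N i.
Proof.
move=> iN /andP[k0 kN] ki; rewrite /plo /phi_hi; split; apply: xn_le => //.
  by case/orP: ki => /eqP -> //=; exact: leq_pred.
by rewrite leq_min kN andbT; case/orP: ki => /eqP ->.
Qed.

Lemma dphi_sqint i : (i <= N)%N -> sqint `]plo R N i, phi_hi R N i[ (dphi i).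
Proof.
move=> /phi_H1[md [id _]]; split => //.
apply/integrableP; split.
  by apply/measurable_EFinP; exact: measurable_funX.
apply: le_lt_trans id; rewrite le_eqVlt; apply/orP; left; apply/eqP.
by apply: eq_integral => x _; rewrite abse_EFin ger0_norm// sqr_ge0.
Qed.

Lemma dphi_integrable i : (i <= N)%N ->
  leb.-integrable `[plo R N i, phi_hi R N i] (EFin \o dphi i).
Proof.
move=> iN; apply: integrable_itv_oo_cc; apply: sqint_integrable => //.
  by rewrite lebesgue_measure_itv /=; case: ifP => // _; rewrite -EFinD ltry.
exact: dphi_sqint.
Qed.

Lemma phiE i x : (i <= N)%N -> plo R N i <= x <= phi_hi R N i ->
  phi i x = phi i (plo R N i) + \int[leb]_(t in `[plo R N i, x]) dphi i t.
Proof. by move=> /phi_H1[_ [_]]; apply. Qed.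

(** On the closed patch [phi i] is a constant plus a primitive, hence continuous; the extreme value
    theorem gives the bound. *)
Lemma phi_meas_bounded i k : (i <= N)%N -> valid_el N k ->
  (k == i) || (k == i.+1) ->
  measurable_fun (el k) (phi i) /\ exists C, forall x, el k x -> `|phi i x| <= C.
Proof.
move=> iN vk ki; have [p1 p2] := patch_el i k iN vk ki.
have pq : plo R N i <= phi_hi R N i.
  by rewrite (le_trans p1)// (le_trans _ p2)// ltW// xn_lt.
have cF := parameterized_integral_continuous pq (dphi_integrable i iN).
pose F x : R := \int[leb]_(t in `[plo R N i, x]) dphi i t.
have {}cF : {within `[plo R N i, phi_hi R N i], continuous F} by exact: cF.
have elI x : el k x -> plo R N i <= x <= phi_hi R N i.
  rewrite /= in_itv/= => /andP[x1 x2].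
  by rewrite (le_trans p1 (ltW x1)) (le_trans (ltW x2) p2).
have phiF x : el k x -> phi i (plo R N i) + F x = phi i x.
  by move=> /elI/phiE ->.
split.
  apply: (@eq_measurable_fun _ _ _ _ _ (fun x => phi i (plo R N i) + F x)).
    by move=> x; rewrite inE => /phiF.
  apply: measurable_funD => //.
  have mF : measurable_fun `[plo R N i, phi_hi R N i] F.
    exact: subspace_continuous_measurable_fun.
  by apply: measurable_funS mF => // x /elI; rewrite /= in_itv.
have [c1 _ h1] := EVT_max pq cF.
have [c2 _ h2] := EVT_min pq cF.
exists (`|phi i (plo R N i)| + (`|F c1| + `|F c2|)) => x xk.
rewrite -phiF//; apply: (le_trans (ler_normD _ _)); rewrite lerD2l.
have xI : x \in `[plo R N i, phi_hi R N i]%R by rewrite in_itv/= elI.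
have := h1 _ xI; have := h2 _ xI => m1 m2.
rewrite ler_norml; apply/andP; split.
  have := ler_norm (- F c2); rewrite normrN.
  by have := normr_ge0 (F c1); lra.
by have := ler_norm (F c1); have := normr_ge0 (F c2); lra.
Qed.

Lemma el_bound k x : valid_el N k -> el k x -> `|x| <= 1.
Proof.
move=> vk /(el_sub01 _ _ vk)/andP[x0 x1].
by rewrite ger0_norm ltW.
Qed.

Lemma phibar_meas_bounded i k : (i <= N)%N -> valid_el N k ->
  (k == i) || (k == i.+1) ->
  measurable_fun (el k) (phibar N phi i k) /\
  exists C, forall x, el k x -> `|phibar N phi i k x| <= C.
Proof.
move=> iN vk ki; have [mp [C hC]] := phi_meas_bounded i k iN vk ki.
rewrite /phibar; set p0 := phi i (xn R N k.-1); set d := phi i _ - p0.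
split.
  apply: measurable_funB => //; apply: measurable_funD => //.
  apply: measurable_funM => //; apply: measurable_funM => //.
  exact: measurable_funB.
exists (C + (`|p0| + (1 + `|xn R N k.-1|) * `|(hh R N)^-1| * `|d|)) => x xk.
apply: (le_trans (ler_normB _ _)); apply: lerD; first exact: hC.
apply: (le_trans (ler_normD _ _)); rewrite lerD2l 2!normrM.
rewrite ler_wpM2r// ler_wpM2r//; apply: (le_trans (ler_normB _ _)).
by rewrite lerD2r; exact: el_bound xk.
Qed.

Lemma Nhat_meas_bounded i k : valid_el N k ->
  measurable_fun (el k) (Nhat N i) /\
  exists C, forall x, el k x -> `|Nhat N i x : R| <= C.
Proof.
move=> vk; rewrite /Nhat; split.
  apply: measurable_funB => //; apply: measurable_funM => //.
  by apply: measurableT_comp => //; exact: measurable_funB.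
exists (1 + (1 + `|xn R N i|) * `|(hh R N)^-1|) => x xk.
apply: (le_trans (ler_normB _ _)); rewrite normr1 lerD2l normrM normr_id.
rewrite ler_wpM2r//; apply: (le_trans (ler_normB _ _)).
by rewrite lerD2r; exact: el_bound xk.
Qed.

(** In the product rule, the first term is bounded and the second is a bounded hat function times an
    L^2 derivative. *)
Lemma dpsi_sqint i k : (i <= N)%N -> valid_el N k ->
  sqint (el k) (dpsi N phi dphi i k).
Proof.
move=> iN vk; rewrite /dpsi.
have [ki|_] := boolP ((k == i) || (k == i.+1)); last exact: sqint_cst.
have [mp [C hC]] := phibar_meas_bounded i k iN vk ki.
have [mN [C' hC']] := Nhat_meas_bounded i k vk.
apply: sqintD => //.
  by apply: sqintZ => //; apply: (@sqint_bounded _ _ _ C) => //; exact: el_fin.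
apply: (sqint_mul_bounded _ _ _ C') => //.
rewrite /dphibar; apply: sqintD => //; last exact: sqint_cst.
have [p1 p2] := patch_el i k iN vk ki.
have sub : el k `<=` `]plo R N i, phi_hi R N i[.
  move=> x; rewrite /= !in_itv/= => /andP[x1 x2].
  by rewrite (le_lt_trans p1 x1) (lt_le_trans x2 p2).
have [md id] := dphi_sqint i iN; split; first exact: measurable_funS md.
exact: integrableS id.
Qed.

(** [dphi] is tied to [phi] only through integrals. If [phibar] vanishes on the element, [phi i] is
    affine there, so its primitive is affine and [dphi i] equals the slope almost everywhere. *)
Lemma dpsi_ae0 i k : (i <= N)%N -> valid_el N k -> ~ nz_el N phi i k ->
  {ae leb, forall x, el k x -> dpsi N phi dphi i k x = 0}.
Proof.
move=> iN vk nz; have [ki|ki] := boolP ((k == i) || (k == i.+1)); last first.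
  apply: aeW => x _; by rewrite /dpsi (negPf ki).
have [p1 p2] := patch_el i k iN vk ki.
have pb0 x : xn R N k.-1 <= x <= xn R N k -> phibar N phi i k x = 0.
  by move=> xk; apply/eqP/negPn/negP => px; apply: nz; exists x.
(* Slope and intercept of the interpolant, the intercept being shifted by the value of [phi i] at
   the left end of the patch. *)
pose s := (phi i (xn R N k) - phi i (xn R N k.-1)) / hh R N.
pose b := phi i (xn R N k.-1) - s * xn R N k.-1 - phi i (plo R N i).
have hF x : xn R N k.-1 < x < xn R N k ->
    \int[leb]_(t in `[plo R N i, x]) dphi i t = b + s * x.
  move=> /andP[x1 x2].
  have xI : plo R N i <= x <= phi_hi R N i.
    by rewrite (le_trans p1 (ltW x1)) (le_trans (ltW x2) p2).
  have := pb0 x; rewrite (ltW x1) (ltW x2) => /(_ isT).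
  rewrite /phibar phiE// => e.
  rewrite /b /s -[LHS]subr0 -e; ring.
have := ae_cst_of_affine_integral (dphi i) _ _ _ _ b s (dphi_integrable i iN) p1 p2 hF.
apply: filterS; first exact: (ae_filter_ringOfSetsType leb).
move=> x dx xk; rewrite /dpsi ki.
move: (xk); rewrite /= in_itv/= => xk'.
rewrite /dphibar dx// subrr mulr0 pb0 ?mulr0 ?addr0//.
by case/andP: xk' => /ltW -> /ltW ->.
Qed.

(** * Stiffness matrices as energy forms *)

Lemma sum_I2 (F : 'I_2 -> R) : \sum_(l < 2) F l = F 0 + F 1.
Proof.
rewrite !big_ord_recl big_ord0 addr0.
by congr (F _ + F _); apply: val_inj.
Qed.

Lemma enum_val_le (j : 'I_(z2 N phi)) : (enum_val j <= N)%N.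
Proof. by rewrite -ltnS. Qed.

Lemma basis_d_lshift i :
  basis_d dphi (lshift (z2 N phi) i) = (fun k x => dNhat R N i.+1 k).
Proof.
rewrite /basis_d; case: splitP => /= [j /ord_inj <- //|j e].
by have := ltn_ord i; rewrite e ltnNge leq_addr.
Qed.

Lemma basis_d_rshift (j : 'I_(z2 N phi)) :
  basis_d dphi (rshift N j) = (fun k x => dpsi N phi dphi (enum_val j) k x).
Proof.
rewrite /basis_d; case: splitP => /= [i e|j' /eqP].
  by have := ltn_ord i; rewrite -e ltnNge leq_addr.
by rewrite eqn_add2l => /eqP /ord_inj <-.
Qed.

Lemma basis_d_sqint s k : valid_el N k -> sqint (el k) (@basis_d R N phi dphi s k).
Proof.
move=> vk; rewrite /basis_d; case: fintype.split => i; first exact: sqint_cst.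
by apply: dpsi_sqint => //; exact: enum_val_le.
Qed.

Lemma Amat_tr : (Amat N a phi dphi)^T = Amat N a phi dphi.
Proof. by apply/matrixP => s t; rewrite !mxE BformC. Qed.

Lemma qform_Amat (y : 'rV[R]_N) (z : 'rV[R]_(z2 N phi)) :
  let v k x := dS1 (y 0) k x + dS2 dphi (z 0) k x in
  qform (Amat N a phi dphi) (row_mx y z) = Bform N a v v.
Proof.
move=> v; pose w : 'rV[R]_(N + z2 N phi) := row_mx y z.
have vE : v = (fun k x => \sum_s w 0 s * basis_d dphi s k x).
  apply/funext => k; apply/funext => x; rewrite big_split_ord /=.
  congr (_ + _); apply: eq_bigr => i _.
    by rewrite /w row_mxEl basis_d_lshift.
  by rewrite /w row_mxEr basis_d_rshift.
rewrite vE Bform_sum; [|exact: basis_d_sqint..].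
rewrite qformE; apply: eq_bigr => s _; apply: eq_bigr => t _.
by rewrite [Amat _ _ _ _ _ _]mxE.
Qed.

Lemma qform_A11 (y : 'rV[R]_N) :
  qform (A11 N a phi dphi) y = Bform N a (dS1 (y 0)) (dS1 (y 0)).
Proof.
rewrite /A11 -qform_row_mx0 qform_Amat.
by congr Bform; apply/funext => k; apply/funext => x;
  rewrite [X in _ + X]big1 ?addr0// => j _; rewrite mxE mul0r.
Qed.

Lemma A22E i j : A22 N a phi dphi i j =
  Bform N a (dpsi N phi dphi (enum_val i)) (dpsi N phi dphi (enum_val j)).
Proof. by rewrite !mxE !basis_d_rshift. Qed.

Lemma qform_A22 (z : 'rV[R]_(z2 N phi)) :
  qform (A22 N a phi dphi) z = Bform N a (dS2 dphi (z 0)) (dS2 dphi (z 0)).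
Proof.
have sj (j : 'I_(z2 N phi)) k : valid_el N k ->
    sqint (el k) (dpsi N phi dphi (enum_val j) k).
  by apply: dpsi_sqint; exact: enum_val_le.
rewrite (Bform_sum _ _ _ _ (fun j : 'I_(z2 N phi) => dpsi N phi dphi (enum_val j))
  (fun j : 'I_(z2 N phi) => dpsi N phi dphi (enum_val j)))//.
by rewrite qformE; apply: eq_bigr => i _; apply: eq_bigr => j _; rewrite A22E.
Qed.

Lemma qform_A11_gt0 (y : 'rV[R]_N) : y != 0 -> 0 < qform (A11 N a phi dphi) y.
Proof.
move=> y0; rewrite qform_A11 lt_neqAle Bform_ge0 ?andbT; last first.
  by move=> k _; exact: sqint_cst.
apply: contra y0 => /eqP/esym/dS1_pos y0.
by apply/eqP/rowP => i; rewrite mxE y0.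
Qed.

(** * Assembly of the enriched block from the elements *)

(* The coefficient at node [x_i], zero when [x_i] is not in T_2. *)
Definition nodal (z : 'I_(z2 N phi) -> R) (i : nat) : R :=
  \sum_(j < z2 N phi | enum_val j == i :> nat) z j.

(** On element [k] only the enrichments at its vertices [k.-1] and [k] survive, which turns the
    global index of T_2 into the local one. *)
Lemma dS2_nodal z k x : (0 < k)%N ->
  dS2 dphi z k x =
  \sum_(l < 2) nodal z (k.-1 + l) * dpsi N phi dphi (k.-1 + l) k x.
Proof.
case: k => // k _; rewrite /dS2 /nodal.
transitivity (\sum_(l < 2) \sum_(j < z2 N phi | enum_val j == (k + l)%N :> nat)
    z j * dpsi N phi dphi (enum_val j) k.+1 x); last first.
  apply: eq_bigr => l _; rewrite mulr_suml.
  by apply: eq_bigr => j /eqP ->.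
under [RHS]eq_bigr do rewrite big_mkcond.
rewrite exchange_big; apply: eq_bigr => j _ /=.
rewrite sum_I2 addn0 addn1.
have [->|k1] := eqVneq (enum_val j : nat) k; first by rewrite ltn_eqF// addr0.
rewrite add0r; case: eqVneq => // k2.
rewrite /dpsi eqSS [k == _]eq_sym [k.+1 == _]eq_sym.
by rewrite (negPf k1) (negPf k2) mulr0.
Qed.

(** By injectivity of [enum_val] the sum has at most one term, so squaring commutes with it. *)
Lemma nodal_sq z i :
  nodal z i ^+ 2 = \sum_(j < z2 N phi | enum_val j == i :> nat) z j ^+ 2.
Proof.
rewrite /nodal; case: (pickP (fun j : 'I_(z2 N phi) => enum_val j == i :> nat)).
  move=> j0 /eqP ji.
  have jE (j : 'I_(z2 N phi)) : (enum_val j == i :> nat) = (j == j0).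
    by rewrite -ji (inj_eq val_inj) (inj_eq enum_val_inj).
  by rewrite !(eq_bigl _ _ jE) !big_pred1_eq.
by move=> h; rewrite !big_pred0// expr0n.
Qed.

Lemma assoc_gate k l : assoc N a phi dphi k l -> gate N phi k l.
Proof. by rewrite /assoc /bel andbb; case: gate => //; rewrite ltxx. Qed.

Lemma local_sqint k l : valid_el N k ->
  sqint (el k) (dpsi N phi dphi (k.-1 + (l : 'I_2)) k).
Proof.
move=> vk; apply: dpsi_sqint => //.
case/andP: vk => k0 kN; apply: leq_trans kN; case: k k0 => // k _.
by rewrite -[k.+1 in leqRHS]addn1 leq_add2l -ltnS.
Qed.

(** Three cases: the vertex is outside T_2 and its coefficient is zero; the gate holds but the
    diagonal entry is zero, so [Bel_null] applies; or [phibar] vanishes on the element and the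
    derivative is zero almost everywhere. *)
Lemma nodal_unassoc z k l v : valid_el N k -> sqint (el k) v ->
  ~~ assoc N a phi dphi k l ->
  nodal z (k.-1 + l) * Bel N a k (dpsi N phi dphi (k.-1 + l) k) v = 0.
Proof.
move=> vk sv nas; have sl := local_sqint k l vk.
have [->|n0] := eqVneq (nodal z (k.-1 + l)) 0; first by rewrite mul0r.
have [j /eqP jE] : exists j : 'I_(z2 N phi), enum_val j == (k.-1 + l)%N :> nat.
  apply/existsP; apply: contraNT n0 => /existsPn h; rewrite /nodal big1// => j.
  by move=> hj; have := h j; rewrite hj.
have kN : (k.-1 + l <= N)%N by rewrite -jE enum_val_le.
rewrite (_ : Bel _ _ _ _ _ = 0) ?mulr0//.
have [g|ng] := boolP (gate N phi k l).
  apply: Bel_null => //; apply/eqP; rewrite eq_le Bel_ge0// andbT leNgt.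
  by move: nas; rewrite /assoc /bel g.
apply: Bel_ae0 => //; apply: dpsi_ae0 => // nz.
move/negP: ng; apply; rewrite /gate kN /=; apply/andP; split; last exact/asboolP.
by rewrite -jE inord_val enum_valP.
Qed.

(** Identifies the element energy with the quadratic form of hypothesis (ii), evaluated at the nodal
    coefficients. *)
Lemma local_form z k : valid_el N k ->
  Bel N a k (dS2 dphi z k) (dS2 dphi z k) =
  \sum_(l < 2 | assoc N a phi dphi k l) \sum_(m < 2 | assoc N a phi dphi k m)
    nodal z (k.-1 + l) * bel N a phi dphi k l m * nodal z (k.-1 + m).
Proof.
move=> vk; have k0 : (0 < k)%N by case/andP: vk.
have sl l := local_sqint k l vk.
have -> : dS2 dphi z k = (fun x => \sum_(l < 2)
    nodal z (k.-1 + l) * dpsi N phi dphi (k.-1 + l) k x).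
  by apply/funext => x; exact: dS2_nodal.
rewrite (Bel_sum _ _ _ _ _ _ _ (fun l : 'I_2 => dpsi N phi dphi (k.-1 + l) k)
  (fun l : 'I_2 => dpsi N phi dphi (k.-1 + l) k))//.
rewrite [RHS]big_mkcond /=; apply: eq_bigr => l _; case: ifPn => al; last first.
  by rewrite big1// => m _; rewrite nodal_unassoc// mul0r.
rewrite [RHS]big_mkcond /=; apply: eq_bigr => m _; case: ifPn => am; last first.
  by rewrite BelC -mulrA [X in _ * X]mulrC nodal_unassoc// mulr0.
by rewrite /bel !assoc_gate.
Qed.

(* [Delta] ranges over the elements of K*_i, a condition weaker than [assoc]; the
   extra elements have [deff = 0], and [0^-2 = 0]. *)
Lemma Delta_sum delta i : (i <= N)%N ->
  \sum_(1 <= k < N.+1) \sum_(l < 2 | assoc N a phi dphi k l)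
    (if i == (k.-1 + l)%N then (deff N a phi dphi delta k l)^-2 else 0) =
  Delta N a phi dphi delta i.
Proof.
move=> iN.
(* Used with [k = i], where [x_i] is local vertex 1, and with [k = i.+1], where it is local vertex
   0. *)
have key k (l : 'I_2) : (valid_el N k -> i = (k.-1 + l)%N) -> (k == i) || (k == i.+1) ->
    (if valid_el N k then if assoc N a phi dphi k l then
       (deff N a phi dphi delta k l)^-2 else 0 else 0) =
    (if inKstar N a phi dphi i k then (deff N a phi dphi delta k l)^-2 else 0).
  move=> kl ki; rewrite /inKstar ki andbT; case: (valid_el N k) kl => //= /(_ isT) kl.
  have [al|nal] := boolP (assoc N a phi dphi k l).
    have /andP[_] := assoc_gate k l al; rewrite -kl => ->; rewrite andbT.
    suff -> : enriched N a phi dphi k by [].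
    move: al; rewrite /enriched -/(assoc N a phi dphi k 0) -/(assoc N a phi dphi k 1).
    by case: l {kl} => -[|[|//]] li al; apply/orP; [left|right];
      move: al; congr (is_true (assoc _ _ _ _ _ _)); apply: val_inj.
  have d0 : deff N a phi dphi delta k l = 0.
    rewrite /deff ifF; last first.
      apply/negbTE; apply: contra nal => /andP[a0 a1].
      by case: l {kl} => -[|[|//]] li; [move: a0|move: a1];
        congr (is_true (assoc _ _ _ _ _ _)); apply: val_inj.
    by rewrite ler0_sqrtr ?invr0// leNgt.
  by rewrite d0 expr0n invr0; case: ifP.
rewrite /Delta -(key i 1) -?(key i.+1 0) ?addn0 ?eqxx ?orbT//; last first.
  by case/andP => i0 _; rewrite addn1 prednK.
(* Each local vertex selects a single [k]. At the end nodes of the mesh the selected [k] may fall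
   outside the range, which matches the [valid_el] test. *)
under eq_bigr do rewrite big_mkcond sum_I2 addn0 addn1.
rewrite big_split /= addrC; congr (_ + _).
  transitivity (\sum_(1 <= k < N.+1 | k == i) if assoc N a phi dphi k 1 then
    (deff N a phi dphi delta k 1)^-2 else 0); last by rewrite big_nat1_eq.
  rewrite [RHS]big_mkcond.
  apply: eq_big_nat => k /andP[k0 _]; rewrite prednK// eq_sym.
  by case: eqP => //; case: ifP.
transitivity (\sum_(1 <= k < N.+1 | k == i.+1) if assoc N a phi dphi k 0 then
  (deff N a phi dphi delta k 0)^-2 else 0); last by rewrite big_nat1_eq.
rewrite [RHS]big_mkcond.
apply: eq_big_nat => -[//|k] _; rewrite eqSS eq_sym /=.
by case: eqP => //; case: ifP.
Qed.

(** Exchange of summation: a sum over elements and their vertices is regrouped by nodes, each node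
    collecting its adjacent elements. *)
Lemma nodal_Delta_sum z delta :
  \sum_(1 <= k < N.+1) \sum_(l < 2 | assoc N a phi dphi k l)
    (nodal z (k.-1 + l) / deff N a phi dphi delta k l) ^+ 2 =
  \sum_j z j ^+ 2 * Delta N a phi dphi delta (enum_val j).
Proof.
transitivity (\sum_(1 <= k < N.+1) \sum_(l < 2 | assoc N a phi dphi k l)
    \sum_j z j ^+ 2 * (if enum_val j == (k.-1 + l)%N :> nat
      then (deff N a phi dphi delta k l)^-2 else 0)).
  apply: eq_bigr => k _; apply: eq_bigr => l _.
  rewrite expr_div_n nodal_sq mulr_suml big_mkcond; apply: eq_bigr => j _.
  by case: eqP => // _; rewrite mulr0.
under eq_bigr do rewrite exchange_big /=.
rewrite exchange_big /=; apply: eq_bigr => j _.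
rewrite -Delta_sum ?enum_val_le// mulr_sumr; apply: eq_bigr => k _.
by rewrite mulr_sumr.
Qed.

Lemma qform_A22_bounds (delta : nat -> 'I_2 -> R) (L U : R) :
  (forall k, valid_el N k -> enriched N a phi dphi k ->
     forall x : 'I_2 -> R,
       let nD := \sum_(l < 2 | assoc N a phi dphi k l)
                   (x l / deff N a phi dphi delta k l) ^+ 2 in
       let q := \sum_(l < 2 | assoc N a phi dphi k l)
                \sum_(m < 2 | assoc N a phi dphi k m)
                   x l * bel N a phi dphi k l m * x m in
       L * nD <= q /\ q <= U * nD) ->
  forall z : 'rV[R]_(z2 N phi),
    let s := \sum_j z 0 j ^+ 2 * Delta N a phi dphi delta (enum_val j) in
    L * s <= qform (A22 N a phi dphi) z /\ qform (A22 N a phi dphi) z <= U * s.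
Proof.
move=> h z s.
have loc k : valid_el N k ->
    let T := \sum_(l < 2 | assoc N a phi dphi k l)
      (nodal (z 0) (k.-1 + l) / deff N a phi dphi delta k l) ^+ 2 in
    let Q := Bel N a k (dS2 dphi (z 0) k) (dS2 dphi (z 0) k) in
    L * T <= Q /\ Q <= U * T.
  move=> vk; rewrite /= local_form//.
  have [ek|] := boolP (enriched N a phi dphi k).
    exact: (h k vk ek (fun l => nodal (z 0) (k.-1 + l))).
  (* An element that is not enriched has no associated vertex, so every sum on it is empty and both
     bounds read 0. *)
  rewrite negb_or -/(assoc N a phi dphi k 0) -/(assoc N a phi dphi k 1).
  move=> /andP[a0 a1].
  have an l : assoc N a phi dphi k l = false.
    apply/negbTE; case: l => -[|[|//]] li; [move: a0|move: a1];
      congr (is_true (~~ assoc _ _ _ _ _ _)); exact: val_inj.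
  by rewrite !big_pred0// !mulr0.
rewrite qform_A22 /Bform /s -nodal_Delta_sum !mulr_sumr.
by split; apply: ler_sum_nat => k /loc[].
Qed.

(** Removes the absolute value in hypothesis (i). *)
Lemma Bform_dS_ge0 (c : 'I_N -> R) (d : 'I_(z2 N phi) -> R) :
  let v k x := dS1 c k x + dS2 dphi d k x in 0 <= Bform N a v v.
Proof.
apply: Bform_ge0 => k vk; apply: sqintD => //; first exact: sqint_cst.
apply: sqint_sum => // j; apply: sqintZ => //; apply: dpsi_sqint => //.
exact: enum_val_le.
Qed.

Lemma A22_diag_ge0 j : 0 <= A22 N a phi dphi j j.
Proof.
rewrite A22E; apply: Bform_ge0 => k vk; apply: dpsi_sqint => //.
exact: enum_val_le.
Qed.

End EnrichedSpace.

(** * Scaled condition number of the stiffness matrix *)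

Theorem mainTheorem3 (R : realType) (N : nat) (a : R -> R) (alpha beta : R)
  (phi dphi : nat -> R -> R) (delta : nat -> 'I_2 -> R)
  (L1 U1 L2 U2 L3 U3 : R) :
  (0 < N)%N ->
  0 < alpha -> alpha <= beta ->
  measurable_fun (`]0, 1[ : set R) a ->
  (forall x, 0 < x < 1 -> alpha <= a x <= beta) ->
  (forall i, (i <= N)%N -> inH1 N phi dphi i) ->
  (forall k, valid_el N k -> assoc N a phi dphi k 0 -> assoc N a phi dphi k 1 ->
     forall l, 0 < delta k l) ->
  0 < L1 -> 0 < U1 -> 0 < L2 -> 0 < U2 -> 0 < L3 -> 0 < U3 ->
  (* (i) *)
  (forall (c : 'I_N -> R) (d : 'I_(z2 N phi) -> R),
     let v1 := dS1 c in
     let v2 := dS2 dphi d in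
     L1 * (enorm2 N a v1 + enorm2 N a v2)
       <= `|Bform N a (fun k x => v1 k x + v2 k x) (fun k x => v1 k x + v2 k x)|
     /\ `|Bform N a (fun k x => v1 k x + v2 k x) (fun k x => v1 k x + v2 k x)|
       <= U1 * (enorm2 N a v1 + enorm2 N a v2)) ->
  (* (ii) *)
  (forall k, valid_el N k -> enriched N a phi dphi k ->
     forall x : 'I_2 -> R,
       let nD := \sum_(l < 2 | assoc N a phi dphi k l)
                   (x l / deff N a phi dphi delta k l) ^+ 2 in
       let q := \sum_(l < 2 | assoc N a phi dphi k l)
                \sum_(m < 2 | assoc N a phi dphi k m)
                   x l * bel N a phi dphi k l m * x m in
       L2 * nD <= q /\ q <= U2 * nD) ->
  (* (iii) *)
  (forall j : 'I_(z2 N phi),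
     L3 <= (A22 N a phi dphi j j)^-1 * Delta N a phi dphi delta (enum_val j)
     /\ (A22 N a phi dphi j j)^-1 * Delta N a phi dphi delta (enum_val j) <= U3) ->
  let K := scond (Amat N a phi dphi) in
  let K11 := scond (A11 N a phi dphi) in
  let lmax := lam_max (scaled (A11 N a phi dphi)) in
  let lmin := lam_min (scaled (A11 N a phi dphi)) in
  L1 / U1 * K11 <= K /\
  K <= K11 * (U1 / L1) * (Num.max 1 (U2 * U3 / lmax) / Num.min 1 (L2 * L3 / lmin)).
Proof.
move=> N0 alpha0 ab ma hab H1 hdelta L10 U10 L20 U20 L30 U30 hi hii hiii K K11 lmax lmin.
(* A diagonal entry is an energy, hence nonnegative. Were it zero, the convention [0^-1 = 0] would
   make the middle term of (iii) vanish, against [0 < L3]. *)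
have dpos j : 0 < A22 N a phi dphi j j.
  rewrite lt_neqAle (A22_diag_ge0 _ _ alpha beta)// andbT.
  apply/negP => /eqP e; have [] := hiii j.
  by rewrite -e invr0 mul0r leNgt L30.
have DA j : L3 * A22 N a phi dphi j j <= Delta N a phi dphi delta (enum_val j) /\
    Delta N a phi dphi delta (enum_val j) <= U3 * A22 N a phi dphi j j.
  have [] := hiii j.
  by rewrite [_^-1 * _]mulrC ler_pdivlMr// ler_pdivrMr.
(* The constants are [l = L2 * L3] and [u = U2 * U3]: (ii) compares the form of [A22] with the sum
   weighted by [Delta], and (iii) compares [Delta] with the diagonal. *)
apply: (@scond_block_bounds R N (z2 N phi) (Amat N a phi dphi)) => //.
- exact: Amat_tr.
- by rewrite mulr_gt0.
- by rewrite mulr_gt0.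
- by move=> y y0; apply: (qform_A11_gt0 _ _ alpha beta).
- move=> y z.
  have -> : qform (ulsubmx (Amat N a phi dphi)) y = enorm2 N a (dS1 (y 0)).
    exact: (qform_A11 _ _ alpha beta).
  have -> : qform (drsubmx (Amat N a phi dphi)) z = enorm2 N a (dS2 dphi (z 0)).
    exact: (qform_A22 _ _ alpha beta).
  rewrite (qform_Amat _ _ alpha beta)//.
  by have := hi (y 0) (z 0); rewrite /= ger0_norm//; apply: (Bform_dS_ge0 _ _ alpha beta).
- move=> z; have [h1 h2] := qform_A22_bounds N a alpha beta phi dphi N0 alpha0
    ma hab H1 delta L2 U2 hii z.
  split.
    apply: le_trans h1; rewrite -mulrA ler_pM2l// mulr_sumr.
    apply: ler_sum => j _; rewrite mulrCA ler_wpM2l ?sqr_ge0//.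
    exact: (DA j).1.
  apply: (le_trans h2); rewrite -mulrA ler_pM2l// mulr_sumr.
  apply: ler_sum => j _; rewrite [leRHS]mulrCA ler_wpM2l ?sqr_ge0//.
  exact: (DA j).2.
Qed.
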